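(* Let $A:\operatorname{D}(A)\to\mathcal H$ be a self-adjoint operator on a Hilbert space $\mathcal H$, let $\mathcal L\subset \operatorname{D}(A)$ be a subspace of finite dimension $n$, let $t\in\mathbb R\setminus\sigma(A)$, and let $m\le n$ be such that $[t-\mathfrak d_m(t),t+\mathfrak d_m(t)]\cap\sigma(A)\subseteq\sigma_{\mathrm{disc}}(A)$. Let $\{\phi_j^t\}_{j=1}^m\subset\mathcal E_{[t-\mathfrak d_m(t),t+\mathfrak d_m(t)]}(A)$ be an orthonormal set such that $|A-t|\phi_j^t=\mathfrak d_j(t)\phi_j^t$ for $j=1,\dots,m$. Suppose that there are $w_j^t\in\mathcal L$ and $0<\varepsilon_j<1$, $j=1,\dots,m$, with $$|w_j^t-\phi_j^t|_t\le\varepsilon_j\quad (j=1,\dots,m)\qquad\text{and}\qquad \sum_{j=1}^m\varepsilon_j^2<\frac{\mathfrak d_1(t)^2}{6}.$$ Then $$F^j_{\mathcal L}(t)-\mathfrak d_j(t)\leq 3\,\frac{\mathfrak d_j(t)}{\mathfrak d_1(t)^2}\sum_{k=1}^j\varepsilon_k^2\qquad\forall j=1,\dots,m.$$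
   Context: $\sigma_{\mathrm{disc}}(A)$ is the discrete spectrum of $A$. For $u\in\operatorname{D}(A)$, $|u|_t=\|(A-t)u\|$. Define $$\mathfrak d_j(t)=\inf_{\substack{\dim V=j\\ V\subset\operatorname{D}(A)}}\ \sup_{0\ne u\in V}\frac{|u|_t}{\|u\|},\qquad F_{\mathcal L}^j(t)=\min_{\substack{\dim V=j\\ V\subset\mathcal L}}\ \max_{0\ne u\in V}\frac{|u|_t}{\|u\|}\quad(1\le j\le n).$$ In particular $\mathfrak d_1(t)=\operatorname{dist}(t,\sigma(A))$. For $I\subset\mathbb R$, $\mathcal E_I(A)=\bigoplus_{\lambda\in I}\ker(A-\lambda)$. $|A-t|$ is the absolute value of the self-adjoint operator $A-t$. *)

(* Defs.v *)
From mathcomp Require Export all_boot all_order all_algebra.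
From mathcomp Require Export all_classical all_reals all_analysis.
From mathcomp Require Export complex sesquilinear.
Export Order.TTheory GRing.Theory Num.Theory.
Export numFieldNormedType.Exports.

Set Implicit Arguments.
Unset Strict Implicit.
Unset Printing Implicit Defensive.

Local Open Scope classical_set_scope.
Local Open Scope ring_scope.
Local Open Scope complex_scope.

Section LinearAlgebra.
Variables (R : realType) (H : lmodType R[i]).

Definition subspace (V : set H) : Prop :=
  V 0 /\ forall (a : R[i]) (u v : H), V u -> V v -> V (a *: u + v).

Definition lin_indep (j : nat) (e : 'I_j -> H) : Prop :=
  forall c : 'I_j -> R[i], \sum_(i < j) c i *: e i = 0 -> forall i, c i = 0.

Definition lin_span (j : nat) (e : 'I_j -> H) : set H :=
  [set u | exists c : 'I_j -> R[i], u = \sum_(i < j) c i *: e i].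

Definition has_dim (V : set H) (j : nat) : Prop :=
  exists2 e : 'I_j -> H, lin_indep e & V = lin_span e.

(* An unbounded operator: a linear map on a subspace [dom].  The values of
   the underlying function outside [dom] are meaningless and never used. *)
Record operator := Operator {
  dom : set H;
  op_fun :> H -> H;
  dom_subspace : subspace dom;
  op_linear : forall (a : R[i]) (u v : H), dom u -> dom v ->
    op_fun (a *: u + v) = a *: op_fun u + op_fun v }.

Lemma op_shift_linear (A : operator) (z : R[i]) (a : R[i]) (u v : H) :
  dom A u -> dom A v ->
  A (a *: u + v) - z *: (a *: u + v) = a *: (A u - z *: u) + (A v - z *: v).
Proof.
move=> Au Av; rewrite op_linear// scalerDr scalerBr !scalerA [z * a]mulrC.
by rewrite opprD addrACA.
Qed.

Definition op_shift (A : operator) (z : R[i]) : operator :=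
  {| dom := dom A; op_fun := fun u => A u - z *: u;
     dom_subspace := dom_subspace A; op_linear := @op_shift_linear A z |}.

Definition op_ker (A : operator) : set H := [set u | dom A u /\ A u = 0].

(* E_I(A), the (algebraic) direct sum of the eigenspaces ker(A - l), l in I;
   the sum of these kernels is automatically direct. *)
Definition eigsum (A : operator) (I : set R) : set H :=
  [set u | exists (k : nat) (l : 'I_k -> R) (v : 'I_k -> H),
    (forall i, I (l i) /\ op_ker (op_shift A (l i)%:C) (v i)) /\
    u = \sum_(i < k) v i].

End LinearAlgebra.

Section Hilbert.
Variables (R : realType) (H : completeNormedModType R[i]).

(* The norms of MathComp-Analysis take values in the scalar field R[i]. *)
Definition hnorm (u : H) : R := complex.Re `|u|.

(* [dot] (linear in its first argument) is the inner product of the Hilbert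
   space [H]. *)
Definition induces_norm (dot : {dot H for Num.conj}) : Prop :=
  forall u : H, dot u u = `|u| ^+ 2.

(* (v, w) lies in the graph of the adjoint of A. *)
Definition adjoint_graph (dot : {dot H for Num.conj}) (A : operator H)
    (v w : H) : Prop :=
  forall u, dom A u -> dot (A u) v = dot u w.

Definition self_adjoint (dot : {dot H for Num.conj}) (A : operator H) : Prop :=
  dense (dom A) /\
  forall v w, adjoint_graph dot A v w <-> dom A v /\ A v = w.

(* T = |B| for a self-adjoint operator B: T is the nonnegative self-adjoint
   square root of B^2, where dom (B^2) = {u in dom B | B u in dom B}. *)
Definition is_abs (dot : {dot H for Num.conj}) (B T : operator H) : Prop :=
  [/\ self_adjoint dot T,
      forall u, dom T u -> 0 <= dot (T u) u,
      forall u, (dom T u /\ dom T (T u)) <-> (dom B u /\ dom B (B u)) &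
      forall u, dom B u -> dom B (B u) -> T (T u) = B (B u)].

Definition resolvent_set (A : operator H) : set R[i] :=
  [set z | (forall v, exists! u, dom A u /\ op_shift A z u = v) /\
           exists c : R, forall u, dom A u -> hnorm u <= c * hnorm (op_shift A z u)].

Definition spectrum (A : operator H) : set R[i] := ~` resolvent_set A.

(* Isolated points of the spectrum that are eigenvalues of finite
   multiplicity. *)
Definition discrete_spectrum (A : operator H) : set R[i] :=
  [set z | isolated (spectrum A : set R[i]^o) z /\
           exists2 k : nat, (0 < k)%N & has_dim (op_ker (op_shift A z)) k].

Definition tnorm (A : operator H) (t : R) (u : H) : R := hnorm (op_shift A t%:C u).

(* Infimum over the j-dimensional subspaces V of S of the supremum of
   |u|_t / ||u|| over nonzero u in V.  The suprema are over nonempty bounded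
   sets when 0 < j; if moreover S is finite-dimensional, both bounds are
   attained. *)
Definition inf_sup (A : operator H) (S : set H) (j : nat) (t : R) : R :=
  inf [set r | exists V : set H, [/\ has_dim V j, V `<=` S &
    r = sup [set tnorm A t u / hnorm u | u in V `\ 0]]].

Definition frakd (A : operator H) (j : nat) (t : R) : R :=
  inf_sup A (dom A) j t.

Definition frakF (A : operator H) (L : set H) (j : nat) (t : R) : R :=
  inf_sup A L j t.

End Hilbert.

(* Main.v *)
Require Import Defs.
From mathcomp Require Import ring lra.

(** The bound is quadratic in the eps_k because of a Galerkin orthogonality.
    Put B = A - t, so that |u|_t = ||B u||, and write d_k for [frakd A k t].
    From |B| phi_k = d_k phi_k one gets B^2 phi_k = d_k^2 phi_k
    ([is_abs_eigen]), hence the phi_k are orthogonal for the form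
    <B u, B v> as well.

    The given w_k only yield an estimate of first order.  Replace them by the
    projections p_k of phi_k onto L which are orthogonal for <B u, B v>
    ([exists_galerkin_projection]); they are at least as close to phi_k
    ([galerkin_best]).  The trial space for F^j is the span of p_1, ..., p_j.
    Take v = sum_k c_k phi_k and u = sum_k c_k p_k, the projection of v, and
    let N = sum_k |c_k|^2 = ||v||^2.
    - Projecting does not increase the form: |u|_t <= |v|_t <= d_j sqrt N
      ([hnorm_Bgalerkin_le]).
    - As v = B^2 psi with psi = sum_k d_k^-2 c_k phi_k, the inner product
      <u - v, v> = <B(u - v), B psi> is unchanged, up to sign, when psi is
      replaced by its own projection error.  It is thus a product of two
      errors, and ||u||^2 >= (1 - 2 x) N with
      x = d_1^-2 sum_(k <= j) eps_k^2 ([hnorm_galerkin_ge]).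
    Since x <= 1/6, these give |u|_t <= d_j (1 - 2 x)^(-1/2) ||u||
    <= d_j (1 + 3 x) ||u||, which is the claim; the lower bound on ||u|| also
    shows that p_1, ..., p_j are linearly independent.

    The argument uses 0 < d_1 <= d_k <= d_j for k <= j.  Positivity of d_1
    comes from the smallness of the eps_k, and monotonicity from the
    variational definition ([inf_sup_homo]). *)

Set Implicit Arguments.
Unset Strict Implicit.
Unset Printing Implicit Defensive.

Local Open Scope classical_set_scope.
Local Open Scope ring_scope.
Local Open Scope complex_scope.

(** * Real inequalities *)

Section RealInequalities.
Variable R : realType.

Lemma sum_sqr_CauchySchwarz (I : finType) (a b : I -> R) :
  (\sum_i a i * b i) ^+ 2 <= (\sum_i a i ^+ 2) * (\sum_i b i ^+ 2).
Proof.
set S := \sum_i a i * b i; set N := \sum_i a i ^+ 2; set E := \sum_i b i ^+ 2.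
have E_ge0 : 0 <= E by apply: sumr_ge0 => i _; exact: sqr_ge0.
have [E0|E_neq0] := eqVneq E 0.
  have b0 i : b i = 0.
    by apply/eqP; rewrite -sqrf_eq0; apply/eqP/(psumr_eq0P _ E0) => // k _;
       exact: sqr_ge0.
  by rewrite E0 mulr0 /S big1 ?expr0n// => i _; rewrite b0 mulr0.
(* The residual of the projection of a on b, scaled by E. *)
have : 0 <= \sum_i (E * a i - S * b i) ^+ 2.
  by apply: sumr_ge0 => i _; exact: sqr_ge0.
have -> : \sum_i (E * a i - S * b i) ^+ 2 = E * (N * E - S ^+ 2).
  transitivity (\sum_i (E ^+ 2 * a i ^+ 2 + - (2 * E * S) * (a i * b i)
                        + S ^+ 2 * b i ^+ 2)).
    by apply: eq_bigr => i _; ring.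
  by rewrite !big_split/= -!mulr_sumr -/S -/N -/E; ring.
by rewrite pmulr_rge0 ?lt_def ?E_neq0// subr_ge0.
Qed.

(** This is where the constants 3 and 1/6 enter: the product is
    1 + x (4 - 3 x - 18 x^2). *)
Lemma sqr1D3x_mul1B2x_ge1 (x : R) : 0 <= x -> x <= 1 / 6 ->
  1 <= (1 + 3 * x) ^+ 2 * (1 - 2 * x).
Proof. by move=> x0 x6; nra. Qed.

End RealInequalities.

(** * Finite-dimensional subspaces and operators on their domain *)

Section LinearSpan.
Variables (R : realType) (H : lmodType R[i]).

Lemma subspaceZ (V : set H) a u : subspace V -> V u -> V (a *: u).
Proof. by move=> [V0 VD] Vu; rewrite -[_ *: _]addr0; exact: VD. Qed.

Lemma subspaceB (V : set H) u v : subspace V -> V u -> V v -> V (u - v).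
Proof. by move=> [V0 VD] Vu Vv; rewrite addrC -scaleN1r; exact: VD. Qed.

Lemma subspace_sum (V : set H) (I : finType) (c : I -> R[i]) (x : I -> H) :
  subspace V -> (forall i, V (x i)) -> V (\sum_i c i *: x i).
Proof.
move=> [V0 VD] Vx; elim/big_rec : _ => // i u _ Vu; exact: VD.
Qed.

Lemma lin_span_subspace j (e : 'I_j -> H) : subspace (lin_span e).
Proof.
split=> [|a u v [c ->] [c' ->]].
  by exists (fun=> 0); rewrite big1// => i _; rewrite scale0r.
exists (fun i => a * c i + c' i); rewrite scaler_sumr -big_split/=.
by apply: eq_bigr => i _; rewrite scalerDl scalerA.
Qed.

Lemma lin_span_sub j (e : 'I_j -> H) (V : set H) :
  subspace V -> (forall i, V (e i)) -> lin_span e `<=` V.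
Proof. by move=> sV Ve _ [c ->]; exact: subspace_sum. Qed.

Lemma lin_span_mem j (e : 'I_j -> H) i : lin_span e (e i).
Proof.
exists (fun k => (k == i)%:R); rewrite (bigD1 i)//= eqxx scale1r big1 ?addr0//.
by move=> k /negbTE ->; rewrite scale0r.
Qed.

Lemma has_dim_subspace V j : has_dim V j -> subspace (V : set H).
Proof. by move=> [e _ ->]; exact: lin_span_subspace. Qed.

Lemma has_dim_drop (V : set H) j : has_dim V j.+1 ->
  exists2 W : set H, has_dim W j & W `<=` V.
Proof.
move=> [e ef ->]; exists (lin_span (e \o lift ord0)); last first.
  by apply: lin_span_sub => [|i]; [exact: lin_span_subspace|exact: lin_span_mem].
exists (e \o lift ord0) => // c c0 i.
have := ef (fun k => oapp c 0 (unlift ord0 k)).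
rewrite big_ord_recl unlift_none/= scale0r add0r.
under eq_bigr do rewrite liftK/=.
by move=> /(_ c0 (lift ord0 i)); rewrite liftK.
Qed.

Lemma has_dim_le (V : set H) j k : has_dim V j -> (k <= j)%N ->
  exists2 W : set H, has_dim W k & W `<=` V.
Proof.
elim: j V => [|j IH] V Vj.
  by rewrite leqn0 => /eqP ->; exists V.
rewrite leq_eqVlt => /predU1P[->|kj]; first by exists V.
have [W Wj WV] := has_dim_drop Vj.
by have [U Uk UW] := IH _ Wj kj; exists U => // u /UW /WV.
Qed.

Section Operator.
Variable B : operator H.

Lemma operator0 : B 0 = 0.
Proof.
have [B0 _] := dom_subspace B.
have := op_linear (-1) B0 B0; rewrite scaler0 addr0 => ->.
by rewrite scaleN1r addNr.
Qed.

Lemma operatorZ a u : dom B u -> B (a *: u) = a *: B u.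
Proof.
have [B0 _] := dom_subspace B => Bu.
by rewrite -[a *: u]addr0 op_linear// operator0 addr0.
Qed.

Lemma operatorB u v : dom B u -> dom B v -> B (u - v) = B u - B v.
Proof.
move=> Bu Bv; have := op_linear (-1) Bv Bu.
by rewrite !scaleN1r ![- _ + _]addrC.
Qed.

Lemma operator_sum (I : finType) (c : I -> R[i]) (x : I -> H) :
  (forall i, dom B (x i)) -> B (\sum_i c i *: x i) = \sum_i c i *: B (x i).
Proof.
move=> Bx; have [B0 BD] := dom_subspace B.
suff : dom B (\sum_i c i *: x i) /\
       B (\sum_i c i *: x i) = \sum_i c i *: B (x i) by case.
elim/big_rec2 : _ => [|i u v _ [Bu <-]]; first by split=> //; exact: operator0.
by split; [exact: BD|exact: op_linear].
Qed.

End Operator.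
End LinearSpan.

(** * The inner product and orthogonal projections *)

Section InnerProduct.
Variables (R : realType) (H : completeNormedModType R[i]).
Implicit Types (u v : H) (a : R[i]).

(** The modulus as a real number, to match [hnorm]. *)
Definition cabs a : R := complex.Re `|a|.

Lemma cabsE a : (cabs a)%:C = `|a|.
Proof. by rewrite /cabs normc_def. Qed.

Lemma hnormE u : (hnorm u)%:C = `|u|.
Proof. by rewrite /hnorm RRe_real ?ger0_real. Qed.

Lemma hnorm_ge0 u : 0 <= hnorm u.
Proof. by rewrite -lecR hnormE normr_ge0. Qed.

Lemma cabs_ge0 a : 0 <= cabs a.
Proof. by rewrite -lecR cabsE normr_ge0. Qed.

Lemma cabs_real (r : R) : cabs r%:C = `|r|.
Proof. by rewrite /cabs normc_def/= expr0n addr0 sqrtr_sqr. Qed.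

Lemma cabsM a b : cabs (a * b) = cabs a * cabs b.
Proof. by apply: (@complexI R); rewrite rmorphM/= !cabsE normrM. Qed.

Lemma conj_real (r : R) : Num.conj (r%:C) = r%:C.
Proof. exact: conjc_real. Qed.

Lemma hnorm0 : hnorm (0 : H) = 0.
Proof. by rewrite /hnorm normr0. Qed.

Lemma hnorm_gt0 u : (0 < hnorm u) = (u != 0).
Proof. by rewrite -ltcR hnormE normr_gt0. Qed.

Lemma hnormZ a u : hnorm (a *: u) = cabs a * hnorm u.
Proof. by apply: (@complexI R); rewrite rmorphM/= cabsE !hnormE normrZ. Qed.

Lemma le_hnorm_sum (I : finType) (c : I -> R[i]) (x : I -> H) :
  hnorm (\sum_i c i *: x i) <= \sum_i cabs (c i) * hnorm (x i).
Proof.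
rewrite -lecR hnormE (le_trans (ler_norm_sum _ _ _))// rmorph_sum/=.
by apply: ler_sum => i _; rewrite normrZ rmorphM/= cabsE hnormE.
Qed.

Variables (dot : {dot H for Num.conj}) (hdot : induces_norm dot).

Lemma dotvv u : dot u u = (hnorm u ^+ 2)%:C.
Proof. by rewrite hdot -hnormE rmorphXn. Qed.

Lemma dotC_eq0 u v : dot u v = 0 -> dot v u = 0.
Proof. by move=> uv; rewrite hermC/= uv raddf0 mulr0. Qed.

Lemma hnormD_orth u v : dot u v = 0 ->
  hnorm (u + v) ^+ 2 = hnorm u ^+ 2 + hnorm v ^+ 2.
Proof.
by move=> uv; apply: (@complexI R); rewrite rmorphD/= -!dotvv hnormDd.
Qed.

Lemma hnormD_sqr u v :
  hnorm (u + v) ^+ 2 = hnorm u ^+ 2 + hnorm v ^+ 2 + 2 * complex.Re (dot u v).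
Proof.
apply: (@complexI R); rewrite -dotvv dnormD/= !rmorphD/= -!dotvv.
congr (_ + _); case: (dot u v) => x y /=.
by apply/eqP; rewrite eq_complex/= subrr eqxx andbT mulr2n mulrDl mul1r.
Qed.

Lemma Re_dot_le u v : complex.Re (dot u v) <= hnorm u * hnorm v.
Proof.
have [->|u0] := eqVneq u 0; first by rewrite linear0l hnorm0 mul0r.
have [->|v0] := eqVneq v 0; first by rewrite raddf0 hnorm0 mulr0.
have uv0 : 0 < hnorm u * hnorm v by rewrite mulr_gt0 ?hnorm_gt0.
rewrite -(ler_pM2l uv0).
have := sqr_ge0 (hnorm ((hnorm v)%:C *: u + (- hnorm u)%:C *: v)).
rewrite hnormD_sqr !hnormZ linearZl_LR/= linearZr_LR/= conj_real.
have -> : complex.Re ((hnorm v)%:C * ((- hnorm u)%:C * dot u v)) =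
    - (hnorm u * hnorm v) * complex.Re (dot u v).
  by case: (dot u v) => a b /=; ring.
rewrite !cabs_real normrN !ger0_norm ?hnorm_ge0//.
by move: (hnorm u) (hnorm v) (complex.Re _) => a b c; nra.
Qed.

Lemma dot_suml (I : finType) (c : I -> R[i]) (x : I -> H) v :
  dot (\sum_i c i *: x i) v = \sum_i c i * dot (x i) v.
Proof. by rewrite linear_sumlz; apply: eq_bigr => i _; rewrite linearZl_LR. Qed.

Lemma hnorm_orth_sum j (c : 'I_j -> R[i]) (x : 'I_j -> H) :
  (forall i k, i != k -> dot (x i) (x k) = 0) ->
  hnorm (\sum_i c i *: x i) ^+ 2 = \sum_i (cabs (c i) * hnorm (x i)) ^+ 2.
Proof.
elim: j c x => [|j IH] c x xx; first by rewrite !big_ord0 hnorm0 expr0n.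
rewrite !big_ord_recl hnormD_orth ?hnormZ ?IH//.
  by move=> i k ik; apply: xx; rewrite (inj_eq lift_inj).
rewrite linearZl_LR/= dotC_eq0 ?mulr0// dot_suml big1// => i _.
by rewrite xx ?mulr0.
Qed.

(** Gram-Schmidt, one vector at a time.  The family need not be free: when the
    new vector lies in the span of the others, its residual r is 0 and so is
    the correction along r. *)
Lemma exists_projection j (e : 'I_j -> H) u :
  exists2 p, lin_span e p & forall q, lin_span e q -> dot (u - p) q = 0.
Proof.
elim: j e u => [|j IH] e u.
  exists 0 => [|q [c ->]]; first exact: (lin_span_subspace e).1.
  by rewrite big_ord0 raddf0.
pose e' := e \o lift ord0.
have se := lin_span_subspace e.
have e'e : lin_span e' `<=` lin_span e.
  by apply: lin_span_sub => // i; exact: lin_span_mem.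
have [p /e'e ep pe] := IH e' u.
have [q e'q qe] := IH e' (e ord0).
set r := e ord0 - q in qe.
have er : lin_span e r.
  by apply: subspaceB => //; [exact: lin_span_mem|exact: e'e].
pose p' := p + (dot (u - p) r / dot r r) *: r.
have p'e' i : lin_span e' i -> dot (u - p') i = 0.
  move=> e'i; rewrite /p' opprD addrA linearBl/= linearZl_LR/= (pe i)// (qe i)//.
  by rewrite mulr0 subr0.
have p'r : dot (u - p') r = 0.
  rewrite /p' opprD addrA linearBl/= linearZl_LR/=.
  have [->|r0] := eqVneq r 0; first by rewrite !raddf0 mulr0 subr0.
  by rewrite divfK ?subrr// dnorm_eq0.
exists p'; first by rewrite /p' addrC; exact: se.2.
move=> v [c ->]; rewrite big_ord_recl linearDr/= -{1}[e ord0](subrK q) -/r.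
rewrite linearZr_LR/= linearDr/= p'r p'e'// add0r mulr0 add0r.
by apply: p'e'; exists (fun i => c (lift ord0 i)).
Qed.

(** Coordinates on a free family are bounded linear forms: if r is the
    component of e_i orthogonal to the other vectors, then the component of
    sum_k c_k e_k along r is c_i r. *)
Lemma coord_le j (e : 'I_j -> H) : lin_indep e ->
  forall i, exists2 K : R, 0 <= K &
    forall c : 'I_j -> R[i], cabs (c i) <= K * hnorm (\sum_k c k *: e k).
Proof.
move=> ef i.
(* Zeroing e_i keeps the index type while spanning the other vectors. *)
pose e' k := if k == i then 0 else e k.
have [p [a ap] pe'] := exists_projection e' (e i).
set r := e i - p in pe'.
have r0 : 0 < hnorm r.
  rewrite hnorm_gt0; apply/eqP => /eqP; rewrite subr_eq0 => /eqP eip.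
  have := ef (fun k => if k == i then 1 else - a k).
  rewrite (bigD1 i)//= eqxx scale1r eip ap (bigD1 i)//= /e' eqxx scaler0 add0r.
  rewrite -big_split/= big1 => [/(_ erefl i)/eqP|k /negbTE ->].
    by rewrite eqxx oner_eq0.
  by rewrite scaleNr subrr.
exists (hnorm r)^-1 => [|c]; first by rewrite invr_ge0 ltW.
rewrite ler_pdivlMl// mulrC -ler_sqr ?nnegrE ?mulr_ge0 ?cabs_ge0 ?hnorm_ge0//.
have e'c : lin_span e' (c i *: p + \sum_(k | k != i) c k *: e k).
  have se' := lin_span_subspace e'; apply: se'.2; first by exists a.
  exists (fun k => c k); rewrite [RHS](bigD1 i)//= {1}/e' eqxx scaler0 add0r.
  by apply: eq_bigr => k /negbTE; rewrite /e' => ->.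
have -> : \sum_k c k *: e k =
    c i *: r + (c i *: p + \sum_(k | k != i) c k *: e k).
  by rewrite addrA -scalerDr subrK (bigD1 i).
rewrite hnormD_orth ?hnormZ ?lerDl ?sqr_ge0//.
by rewrite linearZl_LR/= pe' ?mulr0.
Qed.

End InnerProduct.

(** * The variational quantities *)

Section Variational.
Variables (R : realType) (H : completeNormedModType R[i]).
Variables (dot : {dot H for Num.conj}) (hdot : induces_norm dot).
Variables (A : operator H) (t : R).

Definition ratios (V : set H) : set R :=
  [set tnorm A t u / hnorm u | u in V `\ 0].

Lemma tnorm_ge0 u : 0 <= tnorm A t u.
Proof. exact: hnorm_ge0. Qed.

(** Holds for every V because the supremum of an empty or unbounded set is 0
    by convention. *)
Lemma sup_ratios_ge0 V : 0 <= sup (ratios V).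
Proof.
have [hs|/sup_out -> //] := pselect (has_sup (ratios V)).
have [[r rV] ub] := hs; apply: (le_trans _ (ub_le_sup ub rV)).
by case: rV => u _ <-; rewrite divr_ge0 ?tnorm_ge0 ?hnorm_ge0.
Qed.

Lemma inf_sup_le_sup S (V : set H) j : has_dim V j -> V `<=` S ->
  inf_sup A S j t <= sup (ratios V).
Proof.
move=> Vj VS; apply: ge_inf; last by exists V.
by exists 0 => _ [W [_ _ ->]]; exact: sup_ratios_ge0.
Qed.

Lemma inf_sup_ge0 S j : 0 <= inf_sup A S j t.
Proof.
rewrite /inf_sup; set E := [set _ | _].
have [E0|] := pselect (E !=set0).
  by apply: lb_le_inf => // _ [V [_ _ ->]]; exact: sup_ratios_ge0.
by move=> /set0P/negP/negPn/eqP ->; rewrite inf0.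
Qed.

(** [0 <= M] is needed for V = 0, where the supremum is 0 by convention. *)
Lemma inf_sup_le S (V : set H) j (M : R) : has_dim V j -> V `<=` S -> 0 <= M ->
  (forall u, V u -> tnorm A t u <= M * hnorm u) -> inf_sup A S j t <= M.
Proof.
move=> Vj VS M0 VM; apply: (le_trans (inf_sup_le_sup Vj VS)).
have [V0|/set0P/negP/negPn/eqP ->] := pselect (ratios V !=set0).
  apply: ge_sup => // _ [u [Vu /eqP u0] <-].
  by rewrite ler_pdivrMr ?hnorm_gt0//; exact: VM.
by rewrite sup0.
Qed.

(** An operator is bounded on finite-dimensional spaces.  This makes the
    suprema over trial spaces genuine upper bounds. *)
Lemma tnorm_bounded (V : set H) j : has_dim V j -> V `<=` dom A ->
  exists K : R, forall u, V u -> tnorm A t u <= K * hnorm u.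
Proof.
move=> [e ef ->] VA; pose B := op_shift A t%:C.
have Ae i : dom B (e i) by apply: VA; exact: lin_span_mem.
have /choice[K KP] : forall i, exists K : R, 0 <= K /\
    forall c : 'I_j -> R[i], cabs (c i) <= K * hnorm (\sum_k c k *: e k).
  by move=> i; have [K K0 KP] := coord_le hdot ef i; exists K.
exists (\sum_i K i * hnorm (B (e i))) => _ [c ->].
rewrite /tnorm operator_sum//; apply: (le_trans (le_hnorm_sum _ _)).
rewrite mulr_suml; apply: ler_sum => i _.
by rewrite mulrAC ler_wpM2r ?hnorm_ge0//; exact: (KP i).2.
Qed.

(** Every j-dimensional trial space contains a k-dimensional one, on which the
    supremum is no larger.  The space V ensures that the level j is not the
    infimum of the empty set, which is 0 by convention. *)
Lemma inf_sup_homo S (V : set H) j k : S `<=` dom A -> (k <= j)%N ->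
  has_dim V j -> V `<=` S -> inf_sup A S k t <= inf_sup A S j t.
Proof.
move=> SA kj Vj VS; apply: lb_le_inf.
  by exists (sup (ratios V)); exists V.
move=> _ {V Vj VS} [V [Vj VS ->]].
have [W Wk WV] := has_dim_le Vj kj.
apply: (inf_sup_le Wk) => [u /WV /VS //||u /WV Vu].
  exact: sup_ratios_ge0.
have [->|u0] := eqVneq u 0.
  by rewrite /tnorm operator0 !hnorm0 mulr0.
rewrite -ler_pdivrMr ?hnorm_gt0//; apply: ub_le_sup; last first.
  by exists u => //; split=> //; exact/eqP.
have [K KP] : exists K : R, forall u, V u -> tnorm A t u <= K * hnorm u.
  by apply: (tnorm_bounded Vj) => v /VS /SA.
exists K => _ [v [Vv /eqP v0] <-].
by rewrite ler_pdivrMr ?hnorm_gt0//; exact: KP.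
Qed.

End Variational.

(** * Self-adjoint operators and their absolute value *)

Section Operators.
Variables (R : realType) (H : completeNormedModType R[i]).
Variables (dot : {dot H for Num.conj}) (hdot : induces_norm dot).

Lemma op_shift_symmetric (A : operator H) (t : R) : self_adjoint dot A ->
  {in dom A &, forall u v, dot (op_shift A t%:C u) v = dot u (op_shift A t%:C v)}.
Proof.
move=> [_ Aadj] u v /set_mem Au /set_mem Av /=.
have [_ /(_ (conj Av erefl)) AA] := Aadj v (A v).
rewrite linearBl/= linearBr/= AA// linearZl_LR/= linearZr_LR/=.
by rewrite conj_real.
Qed.

Lemma is_abs_eigen (B T : operator H) (d : R) (phi : H) :
  is_abs dot B T -> dom T phi -> T phi = d%:C *: phi ->
  [/\ dom B phi, dom B (B phi) & B (B phi) = (d ^+ 2)%:C *: phi].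
Proof.
move=> [_ _ TB TBE] Tphi Td.
have [Bphi BBphi] : dom B phi /\ dom B (B phi).
  by apply/TB; split=> //; rewrite Td; apply: subspaceZ => //; exact: dom_subspace.
split=> //; rewrite -TBE// Td operatorZ// Td scalerA -rmorphM/=.
by rewrite expr2.
Qed.

End Operators.

(** * Galerkin projection for the form <B u, B v> *)

Section Galerkin.
Variables (R : realType) (H : completeNormedModType R[i]).
Variables (dot : {dot H for Num.conj}) (hdot : induces_norm dot).
Variable B : operator H.
Hypothesis Bsym :
  forall u v, dom B u -> dom B v -> dot (B u) v = dot u (B v).

(** Project B u on the image of L under B, and lift the result to L. *)
Lemma exists_galerkin_projection (L : set H) n (u : H) :
  has_dim L n -> L `<=` dom B ->
  exists2 p, L p & forall q, L q -> dot (B u - B p) (B q) = 0.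
Proof.
move=> [e _ ->] LB.
have Be i : dom B (e i) by apply: LB; exact: lin_span_mem.
have [_ [c ->] pe] := exists_projection dot (B \o e) (B u).
rewrite -operator_sum// in pe.
exists (\sum_i c i *: e i) => [|_ [c' ->]]; first by exists c.
by apply: pe; exists c'; rewrite operator_sum.
Qed.

(** Pythagoras for the orthogonal parts B (w - p) and B (p - u). *)
Lemma galerkin_best (L : set H) u p w : subspace L -> L `<=` dom B ->
  dom B u -> L p -> L w -> (forall q, L q -> dot (B u - B p) (B q) = 0) ->
  hnorm (B p - B u) <= hnorm (B w - B u).
Proof.
move=> sL LB Bu Lp Lw pq.
rewrite -ler_sqr ?nnegrE ?hnorm_ge0// -[B w - _](subrKA (B p)).
rewrite [leRHS](hnormD_orth hdot)//; first by rewrite lerDr sqr_ge0.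
rewrite -[B p - B u]opprB linearNr/= dotC_eq0 ?oppr0//.
by rewrite -[B w - _]operatorB ?pq//; first [exact: subspaceB|exact: LB].
Qed.

(** * Perturbation of eigenvectors of B^2 under Galerkin projection *)

Section Perturbation.
Variables (L : set H) (j : nat) (phi p : 'I_j -> H) (d eps : 'I_j -> R).
Variables (d1 dj : R).
Hypothesis sL : subspace L.
Hypothesis LB : L `<=` dom B.
Hypothesis Lp : forall i, L (p i).
Hypothesis Bphi : forall i, dom B (phi i).
Hypothesis BBphi : forall i, dom B (B (phi i)).
Hypothesis BBphiE : forall i, B (B (phi i)) = (d i ^+ 2)%:C *: phi i.
Hypothesis phion : forall i k, dot (phi i) (phi k) = (i == k)%:R.
Hypothesis pq : forall i q, L q -> dot (B (phi i) - B (p i)) (B q) = 0.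
Hypothesis peps : forall i, hnorm (B (p i) - B (phi i)) <= eps i.
Hypothesis d1_gt0 : 0 < d1.
Hypothesis d1d : forall i, d1 <= d i.
Hypothesis ddj : forall i, d i <= dj.

Local Notation comb c x := (\sum_(i < j) c i *: x i).
Local Notation weight c := (\sum_(i < j) cabs (c i) ^+ 2).
Local Notation defect := ((\sum_(i < j) eps i ^+ 2) / d1 ^+ 2).

Variable c : 'I_j -> R[i].

Lemma hnorm_eigencomb : hnorm (comb c phi) ^+ 2 = weight c.
Proof.
rewrite (hnorm_orth_sum hdot)//; last by move=> i k /negbTE ik; rewrite phion ik.
apply: eq_bigr => i _; congr (_ ^+ 2).
suff -> : hnorm (phi i) = 1 by rewrite mulr1.
apply/eqP; rewrite -(eqrXn2 (n := 2))// ?hnorm_ge0// expr1n; apply/eqP.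
by apply: (@complexI R); rewrite -(dotvv hdot) phion eqxx.
Qed.

Lemma dot_Beigen i k : dot (B (phi i)) (B (phi k)) = (d k ^+ 2)%:C * (i == k)%:R.
Proof.
by rewrite Bsym// BBphiE linearZr_LR/= phion conj_real.
Qed.

Lemma hnorm_Beigencomb_le : hnorm (B (comb c phi)) ^+ 2 <= dj ^+ 2 * weight c.
Proof.
rewrite operator_sum// (hnorm_orth_sum hdot)//; last first.
  by move=> i k /negbTE ik; rewrite dot_Beigen ik mulr0.
rewrite mulr_sumr; apply: ler_sum => i _.
have -> : (cabs (c i) * hnorm (B (phi i))) ^+ 2 = d i ^+ 2 * cabs (c i) ^+ 2.
  rewrite exprMn mulrC; congr (_ * _); apply: (@complexI R).
  by rewrite -(dotvv hdot) dot_Beigen eqxx mulr1.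
have d0 : 0 <= d i := le_trans (ltW d1_gt0) (d1d i).
by rewrite ler_wpM2r ?sqr_ge0// ler_sqr ?nnegrE// (le_trans d0).
Qed.

Lemma galerkin_orth (b : 'I_j -> R[i]) q : L q ->
  dot (B (comb b p) - B (comb b phi)) (B q) = 0.
Proof.
move=> Lq; rewrite !operator_sum//; last by move=> i; exact: LB.
rewrite -sumrB; under eq_bigr do rewrite -scalerBr.
rewrite dot_suml big1// => i _.
by rewrite -[B (p i) - _]opprB linearNl/= pq// oppr0 mulr0.
Qed.

Lemma galerkin_residual (b : 'I_j -> R[i]) :
  hnorm (B (comb b p) - B (comb b phi)) <= \sum_i cabs (b i) * eps i.
Proof.
rewrite !operator_sum//; last by move=> i; exact: LB.
rewrite -sumrB; under eq_bigr do rewrite -scalerBr.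
apply: (le_trans (le_hnorm_sum _ _)); apply: ler_sum => i _.
by rewrite ler_wpM2l ?cabs_ge0.
Qed.

Lemma hnorm_Bgalerkin_le : hnorm (B (comb c p)) ^+ 2 <= dj ^+ 2 * weight c.
Proof.
apply: le_trans hnorm_Beigencomb_le.
rewrite -[B (comb c phi)](subrK (B (comb c p))).
rewrite (hnormD_orth hdot)//; first by rewrite lerDr sqr_ge0.
rewrite -[_ - B (comb c p)]opprB linearNl/= galerkin_orth ?oppr0//.
exact: subspace_sum.
Qed.

(** The loss of norm is of second order in the projection errors: <u - v, v>
    equals, up to sign, the inner product of the projection errors r of v and
    s of psi = sum_k d_k^-2 c_k phi_k, where B^2 psi = v. *)
Lemma hnorm_galerkin_ge : (1 - 2 * defect) * weight c <= hnorm (comb c p) ^+ 2.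
Proof.
set u := comb c p; set v := comb c phi; set N := weight c.
(* The coordinates of psi. *)
pose b i := c i * ((d i ^+ 2)^-1)%:C.
have d_gt0 i : 0 < d i := lt_le_trans d1_gt0 (d1d i).
have Bb : dom B (comb b phi).
  by apply: subspace_sum => //; exact: dom_subspace.
have BBb : dom B (B (comb b phi)).
  by rewrite operator_sum//; apply: subspace_sum => //; exact: dom_subspace.
have vE : v = B (B (comb b phi)).
  rewrite !operator_sum//; apply: eq_bigr => i _.
  by rewrite BBphiE scalerA /b -mulrA -rmorphM/= mulVf ?mulr1// expf_neq0// gt_eqF.
have Lu : L u by exact: subspace_sum.
have Bv : dom B v by apply: subspace_sum => //; exact: dom_subspace.
have Buv : dom B (u - v).
  by apply: subspaceB; [exact: dom_subspace|exact: LB|].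
pose r := B u - B v; pose s := B (comb b p) - B (comb b phi).
have uvE : dot (u - v) v = - dot r s.
  rewrite {2}vE -Bsym// operatorB//; last exact: LB.
  have rp : dot r (B (comb b p)) = 0 by apply: galerkin_orth; exact: subspace_sum.
  by rewrite -/r /s linearBr/= rp sub0r opprK.
pose S := \sum_i cabs (c i) * eps i.
have rS : hnorm r <= S by exact: galerkin_residual.
have eps_ge0 i : 0 <= eps i by exact: le_trans (hnorm_ge0 _) (peps i).
have sS : hnorm s <= S / d1 ^+ 2.
  apply: (le_trans (galerkin_residual _)); rewrite mulr_suml.
  apply: ler_sum => i _; rewrite mulrAC ler_wpM2r//.
  rewrite /b cabsM ler_wpM2l ?cabs_ge0// cabs_real ger0_norm ?invr_ge0 ?sqr_ge0//.
  rewrite lef_pV2 ?posrE ?exprn_gt0// ler_sqr ?nnegrE//; exact: ltW.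
have S2 : S ^+ 2 <= N * \sum_i eps i ^+ 2 by exact: sum_sqr_CauchySchwarz.
have rs : complex.Re (dot r s) <= defect * N.
  apply: (le_trans (Re_dot_le hdot _ _)).
  apply: (@le_trans _ _ (S * (S / d1 ^+ 2))); first by apply: ler_pM => //; exact: hnorm_ge0.
  rewrite mulrA -expr2 [leRHS]mulrAC ler_wpM2r ?invr_ge0 ?sqr_ge0//.
  by rewrite [leRHS]mulrC.
rewrite -[u](subrK v) (hnormD_sqr hdot) uvE hnorm_eigencomb -/N.
have -> : complex.Re (- dot r s) = - complex.Re (dot r s).
  by case: (dot r s).
have := sqr_ge0 (hnorm (u - v)).
by lra.
Qed.

End Perturbation.
End Galerkin.

(** * The spectral bound *)

Theorem theorem13 (R : realType) (H : completeNormedModType R[i])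
  (dot : {dot H for Num.conj}) (hdot : induces_norm dot)
  (A : operator H) (hA : self_adjoint dot A)
  (n : nat) (L : set H) (hLdim : has_dim L n) (hLdom : L `<=` dom A)
  (t : R) (ht : ~ spectrum A t%:C)
  (m : nat) (hmn : (m <= n)%N)
  (hdisc : forall s : R,
    t - frakd A m t <= s <= t + frakd A m t ->
    spectrum A s%:C -> discrete_spectrum A s%:C)
  (phi : nat -> H)
  (hphiE : forall j : nat, (1 <= j <= m)%N ->
    eigsum A [set` `[t - frakd A m t, t + frakd A m t]] (phi j))
  (hphion : forall j k : nat, (1 <= j <= m)%N -> (1 <= k <= m)%N ->
    dot (phi j) (phi k) = (j == k)%:R)
  (T : operator H) (hT : is_abs dot (op_shift A t%:C) T)
  (hphi : forall j : nat, (1 <= j <= m)%N ->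
    dom T (phi j) /\ T (phi j) = (frakd A j t)%:C *: phi j)
  (w : nat -> H) (eps : nat -> R)
  (hw : forall j : nat, (1 <= j <= m)%N -> L (w j))
  (heps : forall j : nat, (1 <= j <= m)%N -> 0 < eps j < 1)
  (hclose : forall j : nat, (1 <= j <= m)%N ->
    tnorm A t (w j - phi j) <= eps j)
  (hsum : \sum_(1 <= j < m.+1) eps j ^+ 2 < frakd A 1 t ^+ 2 / 6) :
  forall j : nat, (1 <= j <= m)%N ->
    frakF A L j t - frakd A j t <=
      3 * (frakd A j t / frakd A 1 t ^+ 2) * \sum_(1 <= k < j.+1) eps k ^+ 2.
Proof.
move=> j /andP[j1 jm].
set d1 := frakd A 1 t in hsum *; set D := frakd A j t.
rewrite big_add1/= big_mkord in hsum; rewrite big_add1/= big_mkord.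
set E := \sum_(i < j) _.
have sL : subspace L by exact: has_dim_subspace hLdim.
have im (i : 'I_j) : (1 <= i.+1 <= m)%N by rewrite /= (leq_trans (ltn_ord i)).
have E_ge0 : 0 <= E by apply: sumr_ge0 => i _; exact: sqr_ge0.
have E_lt : E < d1 ^+ 2 / 6.
  apply: le_lt_trans hsum; rewrite /E (big_ord_widen m (fun i => eps i.+1 ^+ 2) jm).
  by rewrite big_mkcond/=; apply: ler_sum => i _; case: ifP => // _; exact: sqr_ge0.
have d1_gt0 : 0 < d1.
  rewrite lt_def (inf_sup_ge0 A t (dom A) 1) andbT; apply/eqP => d10.
  by move: E_lt; rewrite d10 expr0n mul0r ltNge E_ge0.
have d_homo k l : (k <= l <= m)%N -> frakd A k t <= frakd A l t.
  move=> /andP[kl lm].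
  have [V Vl VL] := has_dim_le hLdim (leq_trans lm hmn).
  by apply: (inf_sup_homo hdot t (subset_refl (A := dom A)) kl Vl) => u /VL /hLdom.
pose B := op_shift A t%:C.
have Bsym u v : dom B u -> dom B v -> dot (B u) v = dot u (B v).
  by move=> Bu Bv; apply: op_shift_symmetric => //; exact/mem_set.
(* The statement counts from 1, the index type 'I_j from 0. *)
pose f (i : 'I_j) := phi i.+1.
pose d (i : 'I_j) := frakd A i.+1 t.
have fP i : [/\ dom B (f i), dom B (B (f i)) & B (B (f i)) = (d i ^+ 2)%:C *: f i].
  by have [Tf TfE] := hphi _ (im i); exact: is_abs_eigen hT Tf TfE.
have Bf i : dom B (f i) by have [] := fP i.
have BBf i : dom B (B (f i)) by have [] := fP i.
have BBfE i : B (B (f i)) = (d i ^+ 2)%:C *: f i by have [] := fP i.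
have fon i k : dot (f i) (f k) = (i == k)%:R by rewrite hphion ?im.
have /choice[p pP] i : exists p, L p /\
    forall q, L q -> dot (B (f i) - B p) (B q) = 0.
  by have [p] := exists_galerkin_projection dot (f i) hLdim (hLdom : L `<=` dom B);
     exists p.
have Lp i : L (p i) := (pP i).1.
have pq i := (pP i).2.
have peps i : hnorm (B (p i) - B (f i)) <= eps i.+1.
  have Bw : dom B (w i.+1) by apply: hLdom; exact: hw _ (im i).
  apply: le_trans (hclose _ (im i)); rewrite /tnorm -/B -/(f i) operatorB//.
  exact: (galerkin_best hdot sL _ (Bf i) (Lp i) (hw _ (im i)) (pq i)).
have d1d i : d1 <= d i by apply: d_homo; rewrite (andP (im i)).2.
have dD i : d i <= D by apply: d_homo; rewrite ltn_ord.
have D0 : 0 <= D by exact: inf_sup_ge0.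
set x := E / d1 ^+ 2.
have x0 : 0 <= x by rewrite divr_ge0// sqr_ge0.
have x6 : x <= 1 / 6.
  by rewrite ler_pdivrMr ?exprn_gt0// mul1r mulrC ltW.
have num c :=
  hnorm_Bgalerkin_le hdot Bsym sL hLdom Lp Bf BBf BBfE fon pq d1_gt0 d1d dD c.
have den c :=
  hnorm_galerkin_ge hdot Bsym sL hLdom Lp Bf BBf BBfE fon pq peps d1_gt0 d1d c.
have p_free : lin_indep p.
  move=> c c0 i; have := den c; rewrite -/x c0 hnorm0 expr0n/= => den0.
  have : \sum_i cabs (c i) ^+ 2 = 0.
    apply/eqP; rewrite eq_le sumr_ge0 ?andbT => [|k _]; last exact: sqr_ge0.
    by rewrite -(pmulr_rle0 _ (_ : 0 < 1 - 2 * x))//; lra.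
  move/(psumr_eq0P (fun k _ => sqr_ge0 _)) => /(_ i erefl)/eqP.
  rewrite sqrf_eq0 => /eqP ci0; apply/eqP.
  by rewrite -normr_eq0 -cabsE ci0.
have pL : lin_span p `<=` L by exact: lin_span_sub.
suff : frakF A L j t <= D * (1 + 3 * x).
  by rewrite lerBlDl => /le_trans; apply; rewrite /x; lra.
apply: (@inf_sup_le _ _ _ _ _ (lin_span p)) => //; first by exists p.
  by rewrite mulr_ge0//; lra.
move=> _ [c ->]; rewrite -ler_sqr ?nnegrE ?mulr_ge0 ?hnorm_ge0//; last by lra.
apply: (le_trans (num c)); rewrite !exprMn -mulrA ler_wpM2l ?sqr_ge0//.
apply: le_trans (ler_wpM2l (sqr_ge0 _) (den c)); rewrite -/E -/x mulrA.
by rewrite ler_peMl ?sqr1D3x_mul1B2x_ge1// sumr_ge0// => i _; exact: sqr_ge0.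
Qed.
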